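(* Let $p$ and $q$ be primes. If $R$ is a non-commutative ring with unity such that $|R|=p^3q$ and $|Z(R)|$ is not a prime, then $\Gamma_R$ is MSN-integral but not MSN-hyperenergetic.
   Context: For a ring $R$, $Z(R)$ is its center. For a finite non-commutative ring $R$, the commuting graph $\Gamma_R$ is the simple graph with vertex set $R\setminus Z(R)$ in which two distinct vertices are adjacent if they commute. Let $\Gamma$ be a finite simple graph with vertices $v_1,\dots,v_n$. Let $N(v_i)$ be the set of vertices adjacent to $v_i$, let $N^2(v_i)=\big(\bigcup_{u\in N(v_i)}N(u)\big)\setminus\{v_i\}$, and let $\delta_2(v_i)=\sum_{x\in N^2(v_i)}\deg x$. The minimum second neighborhood degree matrix $\mathrm{snm}(\Gamma)$ is the $n\times n$ matrix whose $(i,j)$ entry is $\min\{\delta_2(v_i),\delta_2(v_j)\}$ if $i\neq j$ and $v_i,v_j$ are adjacent, and $0$ otherwise. The MSN-energy $E_{\mathrm{sn}}(\Gamma)$ is the sum of the absolute values of the eigenvalues of $\mathrm{snm}(\Gamma)$, counted with multiplicity. $\Gamma$ is MSN-integral if all eigenvalues of $\mathrm{snm}(\Gamma)$ are integers, and MSN-hyperenergetic if $E_{\mathrm{sn}}(\Gamma)>E_{\mathrm{sn}}(K_n)$, where $K_n$ is the complete graph on $n=|V(\Gamma)|$ vertices. *)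

(* Defs.v *)
From HB Require Import structures.
From mathcomp Require Import all_boot all_order all_algebra all_field.

Set Implicit Arguments.
Unset Strict Implicit.
Unset Printing Implicit Defensive.

Import Order.TTheory GRing.Theory Num.Theory.
Local Open Scope ring_scope.

Record sgraph := SGraph {
  vertex :> finType;
  adj : rel vertex;
  adj_sym : symmetric adj;
  adj_irrefl : irreflexive adj }.

Section Graph.
Variable G : sgraph.

Definition neighbors (v : G) : {set G} := [set u | adj v u].

Definition degree (v : G) : nat := #|neighbors v|.

Definition neighbors2 (v : G) : {set G} :=
  (\bigcup_(u in neighbors v) neighbors u) :\ v.

Definition delta2 (v : G) : nat := (\sum_(x in neighbors2 v) degree x)%N.

(* The vertices v_1, ..., v_n are listed by [enum_val]. The entries are natural
   numbers, so the eigenvalues are algebraic and algC contains all of them. *)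
Definition snm : 'M[algC]_#|G| :=
  \matrix_(i, j)
    let u := enum_val i in let v := enum_val j in
    if (i != j) && adj u v then (minn (delta2 u) (delta2 v))%:R else 0.

End Graph.

(* Eigenvalues repeated according to their multiplicity as roots of the
   characteristic polynomial; the order of the list is unspecified. *)
Definition spectrum (n : nat) (A : 'M[algC]_n) : seq algC :=
  sval (closed_field_poly_normal (char_poly A)).

Lemma char_poly_spectrum (n : nat) (A : 'M[algC]_n) :
  char_poly A = \prod_(z <- spectrum A) ('X - z%:P).
Proof.
rewrite /spectrum; case: closed_field_poly_normal => r /=.
by rewrite (monicP (char_poly_monic A)) scale1r.
Qed.

Lemma mem_spectrum (n : nat) (A : 'M[algC]_n) (z : algC) :
  (z \in spectrum A) = eigenvalue A z.
Proof. by rewrite eigenvalue_root_char char_poly_spectrum root_prod_XsubC. Qed.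

Definition msn_energy (G : sgraph) : algC := \sum_(z <- spectrum (snm G)) `|z|.

Definition msn_integral (G : sgraph) : Prop :=
  forall z : algC, eigenvalue (snm G) z -> z \is a Num.int.

Section CompleteGraph.
Variable n : nat.

Definition complete_adj : rel 'I_n := fun i j => i != j.

Fact complete_adj_sym : symmetric complete_adj.
Proof. by move=> i j; rewrite /complete_adj eq_sym. Qed.

Fact complete_adj_irrefl : irreflexive complete_adj.
Proof. by move=> i; rewrite /complete_adj eqxx. Qed.

Definition complete_graph : sgraph :=
  SGraph complete_adj_sym complete_adj_irrefl.

End CompleteGraph.

(* Both energies are real, so the partial order of algC compares them. *)
Definition msn_hyperenergetic (G : sgraph) : Prop :=
  msn_energy G > msn_energy (complete_graph #|G|).

Section CommutingGraph.
Variable R : finNzRingType.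

Definition ring_center : {set R} := [set x | [forall y, x * y == y * x]].

Definition noncentral : finType := {x : R | x \notin ring_center}.

Definition commuting_adj : rel noncentral :=
  fun x y => (x != y) && (val x * val y == val y * val x).

Fact commuting_adj_sym : symmetric commuting_adj.
Proof. by move=> x y; rewrite /commuting_adj eq_sym [_ * _ == _]eq_sym. Qed.

Fact commuting_adj_irrefl : irreflexive commuting_adj.
Proof. by move=> x; rewrite /commuting_adj eqxx. Qed.

Definition commuting_graph : sgraph :=
  SGraph commuting_adj_sym commuting_adj_irrefl.

End CommutingGraph.

(* Main.v *)
(** For a noncentral [x] the chain [Z(R) < C(x) < R] of additive groups factors
    [p ^ 3 * q] as [#|Z(R)|] times two indices. The order of the center is
    neither 1 nor a prime, so counting prime factors both indices are primes.
    They are equal, since a group [R / Z(R)] of order the product of two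
    distinct primes would be cyclic and [R] commutative. Hence [C(x) / Z(R)] has
    prime order, the same for all [x], so commuting is an equivalence relation
    on noncentral elements and the graph is a disjoint union of cliques of a
    common size [m >= 4]. Its matrix is [(m - 1) ^ 2 *: (B - 1)] with
    [B ^ 2 = m *: B], so its eigenvalues are [- (m - 1) ^ 2] and
    [(m - 1) ^ 3]. With [n] vertices the energy is [2 * n * (m - 1) ^ 3 / m],
    which is increasing in [m], and [m = n] for the complete graph. *)
Require Import Defs.
From mathcomp Require Import all_boot all_order all_algebra all_fingroup all_solvable all_field.
From mathcomp Require Import ring zify.
Set Implicit Arguments.
Unset Strict Implicit.
Unset Printing Implicit Defensive.
Import Order.TTheory GRing.Theory Num.Theory.
Local Open Scope ring_scope.

(** * Spectrum and trace *)

Lemma size_spectrum (n : nat) (A : 'M[algC]_n) : size (spectrum A) = n.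
Proof.
apply: succn_inj; rewrite -(size_prod_XsubC _ id) /= -char_poly_spectrum.
by rewrite size_char_poly.
Qed.

(** Vieta: up to sign, both sides are the coefficient of degree [n - 1] of the characteristic
    polynomial. For [n = 0] both are empty sums. *)
Lemma sum_spectrum (n : nat) (A : 'M[algC]_n) : \sum_(z <- spectrum A) z = \tr A.
Proof.
have sz := size_spectrum A.
have [n0|n_gt0] := posnP n.
  rewrite /mxtrace [RHS]big1 => [|i _]; last by have := ltn_ord i; lia.
  have /size0nil-> : size (spectrum A) = 0%N by rewrite sz.
  by rewrite big_nil.
apply: oppr_inj; rewrite -char_poly_trace // char_poly_spectrum.
have := @coefPn_prod_XsubC _ (spectrum A).
by rewrite sz -lt0n => ->.
Qed.

(** * Disjoint unions of cliques of size [m], given as the fibers of [f] *)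

Section DisjointCliques.
Variables (G : sgraph) (T : eqType) (f : G -> T) (m : nat).
Hypothesis adjE : forall x y : G, adj x y = (x != y) && (f x == f y).
Hypothesis card_class : forall x : G, #|[set y | f x == f y]| = m.
Hypothesis m_gt2 : (2 < m)%N.

Lemma degree_cliques (x : G) : degree x = m.-1.
Proof.
rewrite -(card_class x) (cardsD1 x) inE eqxx /=; apply: eq_card => y.
by rewrite !inE adjE eq_sym.
Qed.

Lemma neighbors2_cliques (x : G) : neighbors2 x = neighbors x.
Proof.
apply/setP=> y; rewrite !inE adjE eq_sym.
have [// | nxy /=] := eqVneq x y.
apply/bigcupP/idP => [[u] | /eqP fxy].
  by rewrite !inE !adjE => /andP[_ /eqP->] /andP[].
(* Since [m > 2], the clique of [x] and [y] has a third vertex [u], through which [y] is reached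
   from [x] in two steps. *)
have /card_gt0P[u] : (0 < #|[set z | f x == f z] :\: [set x; y]|)%N.
  have := cardsID [set x; y] [set z | f x == f z]; rewrite card_class.
  have := subset_leq_card (subsetIr [set z | f x == f z] [set x; y]).
  by rewrite cards2 nxy /=; lia.
rewrite !inE negb_or => /andP[/andP[nux nuy] fxu].
exists u; first by rewrite !inE adjE eq_sym nux.
by rewrite !inE adjE nuy -fxy eq_sym.
Qed.

Lemma delta2_cliques (x : G) : delta2 x = (m.-1 ^ 2)%N.
Proof.
rewrite /delta2 neighbors2_cliques (eq_bigr (fun=> m.-1)); last first.
  by move=> y _; apply: degree_cliques.
by rewrite sum_nat_const -/(degree x) degree_cliques.
Qed.

Let B : 'M[algC]_#|G| := \matrix_(i, j) (f (enum_val i) == f (enum_val j))%:R.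

(** Up to the order of the vertices, [B] is block diagonal with all-ones blocks of size [m]. *)
Let BB : B *m B = m%:R *: B.
Proof.
apply/matrixP=> i j; rewrite !mxE.
under eq_bigr => k _ do rewrite !mxE -natrM mulnb.
rewrite -(card_class (enum_val i)) -sum1_card.
have [fij | nfij] := eqVneq (f (enum_val i)) (f (enum_val j)); last first.
  rewrite mulr0 big1 // => k _; case: eqP => //= <-.
  by rewrite (negPf nfij).
rewrite mulr1 natr_sum [RHS]big_mkcond (reindex (@enum_val G G)) /=; last first.
  by apply: onW_bij; apply: enum_val_bij.
apply: eq_bigr => k _; rewrite inE -fij [X in _ && X]eq_sym andbb.
by case: eqP.
Qed.

Let d : algC := (m%:R - 1) ^+ 2.

Let snmE : snm G = d *: (B - 1%:M).
Proof.
apply/matrixP=> i j; rewrite !mxE /= !delta2_cliques minnn adjE (inj_eq enum_val_inj).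
have [-> | nij] := eqVneq i j; first by rewrite eqxx subrr mulr0.
rewrite /= subr0; case: eqP => _; last by rewrite mulr0.
by rewrite mulr1 natrX -subn1 natrB // (leq_trans _ m_gt2).
Qed.

Lemma eigenvalue_cliques (z : algC) :
  eigenvalue (snm G) z -> (z == - d) || (z == d * (m%:R - 1)).
Proof.
rewrite snmE => /eigenvalueP[v vA v_neq0].
rewrite -subr_eq0 opprK -[z == _ * _]subr_eq0 -mulf_eq0.
suff /eqP : ((z + d) * (z - d * (m%:R - 1))) *: v = 0.
  by rewrite scaler_eq0 (negPf v_neq0) orbF.
(* [(z + d) *: v] is a multiple of [v *m B], so [B ^ 2 = m *: B] makes [B] act on it as [m].
   Computing its image in two ways yields the quadratic equation for [z]. *)
have vB : d *: (v *m B) = (z + d) *: v.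
  by move: vA; rewrite -scalemxAr mulmxBr mulmx1 scalerBr => /eqP; rewrite subr_eq -scalerDl => /eqP.
have wB : ((z + d) *: v) *m B = m%:R *: ((z + d) *: v).
  by rewrite -vB -scalemxAl -mulmxA BB -scalemxAr !scalerA mulrC.
have : (z + d) *: ((z + d) *: v) = (d * m%:R) *: ((z + d) *: v).
  by rewrite -[RHS]scalerA -wB -{1}vB -scalemxAl !scalerA mulrC.
move/eqP; rewrite -subr_eq0 !scalerA -scalerBl => /eqP <-.
by congr (_ *: _); ring.
Qed.

Lemma msn_integral_cliques : msn_integral G.
Proof.
have m1_int : (m%:R - 1 : algC) \is a Num.int by rewrite rpredB ?rpred1 ?intr_nat.
move=> z /eigenvalue_cliques/orP[] /eqP->; first by rewrite rpredN rpredX.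
by rewrite rpredM ?rpredX.
Qed.

(* On the two possible eigenvalues [z] the absolute value is an affine function
   of [z], and the trace vanishes: multiplicities are not needed. *)
Lemma msn_energy_cliques :
  m%:R * msn_energy G = (2 * #|G|)%:R * (m%:R - 1) ^+ 3.
Proof.
have m1 : 0 <= m%:R - 1 :> algC by rewrite subr_ge0 ler1n; lia.
(* Linear interpolation of [|z|] at the points [- d] and [d * (m - 1)], which are [d * m] apart; the
   factor [m] clears the denominator. *)
have absE z : z \in spectrum (snm G) ->
    m%:R * `|z| = 2 * d * (m%:R - 1) + (m%:R - 2) * z.
  rewrite mem_spectrum => /eigenvalue_cliques/orP[] /eqP->.
    by rewrite normrN ger0_norm ?exprn_ge0 //; ring.
  by rewrite ger0_norm ?mulr_ge0 ?exprn_ge0 //; ring.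
rewrite /msn_energy mulr_sumr big_seq (eq_bigr _ absE) -big_seq big_split /=.
rewrite -[X in _ + X]mulr_sumr sum_spectrum.
have -> : \tr (snm G) = 0 by rewrite /mxtrace big1 // => i _; rewrite mxE eqxx.
rewrite big_const_seq count_predT size_spectrum iter_addr_0 -mulr_natr natrM /d.
by ring.
Qed.
End DisjointCliques.

(** * Comparison with the complete graph *)

Lemma msn_energy_complete (n : nat) : (2 < n)%N ->
  msn_energy (complete_graph n) = 2 * (n%:R - 1) ^+ 3.
Proof.
move=> n_gt2; have n_neq0 : n%:R != 0 :> algC by rewrite pnatr_eq0; lia.
apply: (mulfI n_neq0).
(* A constant labelling turns the complete graph into a single class, with [m = n]. *)
rewrite (@msn_energy_cliques (complete_graph n) _ (fun=> tt)) //.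
- by rewrite card_ord natrM; ring.
- by move=> x y; rewrite /= andbT.
- move=> x; rewrite -[RHS]card_ord -cardsT; apply: eq_card => y.
  by rewrite !inE.
Qed.

Lemma not_msn_hyperenergetic_cliques (G : sgraph) (T : eqType) (f : G -> T)
    (m : nat) :
  (forall x y : G, adj x y = (x != y) && (f x == f y)) ->
  (forall x : G, #|[set y | f x == f y]| = m) -> (2 < m)%N ->
  ~ msn_hyperenergetic G.
Proof.
move=> adjE card_class m_gt2.
have m_gt0 : 0 < m%:R :> algC by rewrite ltr0n; lia.
have energyE := msn_energy_cliques adjE card_class m_gt2.
rewrite /msn_hyperenergetic; apply/negP.
have [G0 | /card_gt0P[x _]] := posnP #|G|.
  suff -> : msn_energy G = 0 by rewrite le_gtF // sumr_ge0.
  by apply: (mulfI (lt0r_neq0 m_gt0)); rewrite energyE G0 mulr0 mul0r.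
have mn : (m <= #|G|)%N by rewrite -(card_class x) max_card.
rewrite -(ltr_pM2l m_gt0) energyE msn_energy_complete; last by lia.
have -> : m%:R - 1 = m.-1%:R :> algC by rewrite -subn1 natrB //; lia.
have -> : #|G|%:R - 1 = #|G|.-1%:R :> algC by rewrite -subn1 natrB //; lia.
rewrite -!natrX -!natrM ltr_nat -leqNgt.
(* With [n] the number of vertices, the goal [n * (m - 1) ^ 3 <= m * (n - 1) ^ 3], up to the factor
   2, is the product of these two inequalities, both due to [m <= n]. *)
have le_sq : (m.-1 ^ 2 <= #|G|.-1 ^ 2)%N by rewrite leq_exp2r //; lia.
have le_lin : (#|G| * m.-1 <= m * #|G|.-1)%N by nia.
by have := leq_mul le_sq le_lin; rewrite !expnS !expn0; lia.
Qed.

(** * Counting prime factors with multiplicity *)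

Section BigOmega.
Variable N : nat.

(** The range of summation is fixed by [N], so that additivity holds term by term; [logn r n]
    vanishes when [r] is not prime. The count is complete for [n <= N]. *)
Definition bigomega (n : nat) : nat := (\sum_(r < N.+1) logn r n)%N.

Lemma bigomegaM (a b : nat) :
  (0 < a -> 0 < b -> bigomega (a * b) = bigomega a + bigomega b)%N.
Proof.
by move=> a_gt0 b_gt0; rewrite -big_split; apply: eq_bigr => r _; apply: lognM.
Qed.

Lemma bigomega_prime (r : nat) : prime r -> (r <= N)%N -> bigomega r = 1%N.
Proof.
rewrite -ltnS => r_prime rN; rewrite /bigomega (bigD1 (Ordinal rN)) //=.
rewrite logn_prime // eqxx big1 // => s; rewrite -val_eqE /= => /negPf.
by rewrite logn_prime // => ->.
Qed.

Lemma bigomega_gt0 (n : nat) : (1 < n <= N)%N -> (0 < bigomega n)%N.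
Proof.
case/andP=> n_gt1 nN; have r_prime := pdiv_prime n_gt1.
have rn : (pdiv n <= n)%N by rewrite pdiv_leq //; lia.
have r_gt0 := prime_gt0 r_prime; have m_gt0 : (0 < n %/ pdiv n)%N by rewrite divn_gt0.
rewrite -(divnK (pdiv_dvd n)) bigomegaM //.
by rewrite (bigomega_prime r_prime (leq_trans rn nN)) addn1.
Qed.

Lemma bigomega_gt1 (n : nat) :
  (1 < n <= N)%N -> ~~ prime n -> (1 < bigomega n)%N.
Proof.
case/andP=> n_gt1 nN; apply: contraR; rewrite -leqNgt.
have r_prime := pdiv_prime n_gt1; have r_gt0 := prime_gt0 r_prime.
have rn : (pdiv n <= n)%N by rewrite pdiv_leq //; lia.
have m_gt0 : (0 < n %/ pdiv n)%N by rewrite divn_gt0.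
rewrite -{1}(divnK (pdiv_dvd n)) bigomegaM //.
rewrite (bigomega_prime r_prime (leq_trans rn nN)).
have [m1 | m_neq1] := eqVneq (n %/ pdiv n)%N 1%N.
  by rewrite -[X in prime X](divnK (pdiv_dvd n)) m1 mul1n.
have mN : (1 < n %/ pdiv n <= N)%N by rewrite (leq_trans (leq_div _ _) nN); lia.
by have := bigomega_gt0 mN; lia.
Qed.

End BigOmega.

(** Of the four prime factors [z] takes at least two, which leaves exactly one each for [a] and
    [b]. *)
Lemma prime_factors_p3q (p q z a b : nat) :
  prime p -> prime q -> (z * a * b = p ^ 3 * q)%N ->
  (1 < z -> ~~ prime z -> 1 < a -> 1 < b -> prime a /\ prime b)%N.
Proof.
move=> p_prime q_prime zabE z_gt1 z_nprime a_gt1 b_gt1.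
set N := (p ^ 3 * q)%N; have [p_gt1 q_gt1] := (prime_gt1 p_prime, prime_gt1 q_prime).
have pN : (p <= N)%N by rewrite /N !expnS expn0; nia.
have qN : (q <= N)%N by rewrite leq_pmull // expn_gt0; lia.
have oN : bigomega N N = 4%N.
  rewrite {2}/N !expnSr expn0 mul1n !bigomegaM ?muln_gt0; try lia.
  by rewrite !bigomega_prime.
have N_gt0 : (0 < N)%N by apply: leq_trans pN; lia.
have zN : (1 < z <= N)%N by rewrite z_gt1 dvdn_leq // /N -zabE -mulnA dvdn_mulr.
have aN : (1 < a <= N)%N by rewrite a_gt1 dvdn_leq // /N -zabE dvdn_mulr ?dvdn_mull.
have bN : (1 < b <= N)%N by rewrite b_gt1 dvdn_leq // /N -zabE dvdn_mull.
have oz := bigomega_gt1 zN z_nprime.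
have oa := bigomega_gt0 aN; have ob := bigomega_gt0 bN.
move: oN; rewrite {2}/N -zabE !bigomegaM ?muln_gt0; try lia.
move=> o4; split.
  by apply: contraT => /(bigomega_gt1 aN); lia.
by apply: contraT => /(bigomega_gt1 bN); lia.
Qed.

(** * Centralizers and the center as additive groups *)

Section Centralizers.
Variable R : finNzRingType.

Definition centralizer (x : R) : {set R} := [set y | x * y == y * x].

(** The group law on [R] is addition: here and below, indices, quotients and orders of elements are
    additive. *)
Lemma centralizer_group_set (x : R) : group_set (centralizer x).
Proof.
apply/group_setP; split=> [|y z]; rewrite !inE.
  by rewrite mulr0 mul0r.
by move=> /eqP yx /eqP zx; rewrite mulrDl mulrDr yx zx.
Qed.
Canonical centralizer_group (x : R) := Group (centralizer_group_set x).

Lemma ring_centerP (x : R) :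
  reflect (forall y, x * y = y * x) (x \in ring_center R).
Proof. by rewrite inE; apply: (iffP forallP) => xC y; apply/eqP/xC. Qed.

Lemma ring_center_group_set : group_set (ring_center R).
Proof.
apply/group_setP; split=> [|y z].
  by apply/ring_centerP=> y; rewrite mulr0 mul0r.
move=> /ring_centerP yC /ring_centerP zC; apply/ring_centerP => t.
by rewrite mulrDl mulrDr yC zC.
Qed.
Canonical ring_center_group := Group ring_center_group_set.

Lemma ring_center_gt1 : (1 < #|ring_center R|)%N.
Proof.
have : [set 0; 1] \subset ring_center R.
  apply/subsetP=> x /set2P[] ->; apply/ring_centerP=> y.
    by rewrite mulr0 mul0r.
  by rewrite mulr1 mul1r.
by move/subset_leq_card; rewrite cards2 eq_sym oner_neq0.
Qed.

Lemma center_sub_centralizer (x : R) : ring_center R \subset centralizer x.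
Proof. by apply/subsetP=> y /ring_centerP yC; rewrite inE yC. Qed.

Lemma centralizer_id (x : R) : x \in centralizer x.
Proof. by rewrite inE. Qed.

Lemma centralizer_full (x : R) :
  ([set: R] \subset centralizer x) = (x \in ring_center R).
Proof.
apply/subsetP/ring_centerP => [xC y | xC y _]; last by rewrite inE xC.
by apply/eqP; have := xC y (in_setT y); rewrite inE.
Qed.

Lemma center_normal : [set: R] \subset 'N(ring_center R)%g.
Proof.
by apply: sub_abelian_norm (subsetT _); exact: FinRing.zmod_abelian.
Qed.

(** For distinct primes, the product of elements of orders [a] and [b] generates the abelian
    quotient by the center. A representative [g] of it turns out to be central, although its coset
    has order [a * b > 1]. *)
Lemma center_index_primes_eq (a b : nat) :
  prime a -> prime b -> #|[set: R] : ring_center R|%g = (a * b)%N -> a = b.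
Proof.
move=> a_prime b_prime iE; apply/eqP; apply: contraT => nab.
have cRZ : #|[set: R] / ring_center R|%g = (a * b)%N.
  by rewrite card_quotient // center_normal.
have [|x xRZ ox] := @Cauchy _ a ([set: R] / ring_center R)%G a_prime.
  by rewrite /= cRZ dvdn_mulr.
have [|y yRZ oy] := @Cauchy _ b ([set: R] / ring_center R)%G b_prime.
  by rewrite /= cRZ dvdn_mull.
have abRZ : abelian ([set: R] / ring_center R)%g.
  by rewrite quotient_abelian // FinRing.zmod_abelian.
have oxy : #[x * y]%g = (a * b)%N.
  rewrite orderM ?ox ?oy //; first by apply: (centsP abRZ).
  by rewrite prime_coprime // dvdn_prime2.
have /morphimP[g gN _ xyE] := groupM xRZ yRZ.
suff gZ : g \in ring_center R.
  move: oxy; rewrite xyE /= coset_id // order1.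
  by have := prime_gt1 a_prime; have := prime_gt1 b_prime; nia.
(* The centralizer of [g] contains the center and [g], so its image in the quotient contains a
   generator. *)
rewrite -centralizer_full -(@quotientSGK _ ring_center_group) ?center_normal ?center_sub_centralizer //.
have : (<[x * y]> \subset centralizer g / ring_center R)%g.
  by rewrite cycle_subG xyE; apply: mem_quotient; apply: centralizer_id.
suff -> : (<[x * y]> = [set: R] / ring_center R)%g by [].
by apply/eqP; rewrite eqEcard cycle_subG groupM //= cRZ -oxy.
Qed.

Lemma centralizer_index_gt1 (x : R) : x \notin ring_center R ->
  (1 < #|centralizer x : ring_center R|%g)%N
    /\ (1 < #|[set: R] : centralizer x|%g)%N.
Proof.
move=> xZ; rewrite !indexg_gt1 centralizer_full xZ; split=> //.
by apply: contra xZ => /subsetP; apply; apply: centralizer_id.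
Qed.

(** The intersection of the two centralizers contains the noncentral [y], so it lies strictly above
    the center. As the index of the center in [centralizer x] is prime, the intersection is all of
    [centralizer x]. *)
Lemma centralizer_sub (x y : R) :
  prime #|centralizer x : ring_center R|%g ->
  y \notin ring_center R -> x * y = y * x -> centralizer x \subset centralizer y.
Proof.
move=> a_prime yZ xy; set I := (centralizer_group x :&: centralizer_group y)%G.
have ZI : ring_center R \subset I by rewrite subsetI !center_sub_centralizer.
have IZ : (1 < #|I : ring_center R|%g)%N.
  rewrite indexg_gt1; apply: contra yZ => /subsetP; apply.
  by apply/setIP; rewrite /= !inE xy.
have IE := Lagrange_index (subsetIl _ _ : I \subset centralizer_group x) ZI.
have /primeP[_ /(_ #|I : ring_center R|%g)] := a_prime.
rewrite -IE dvdn_mull // => /(_ isT)/orP[/eqP I1|/eqP I2]; first by lia.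
have : ~~ (1 < #|centralizer x : I|%g)%N.
  by rewrite -leqNgt; move: I2 IZ; rewrite /=; nia.
by rewrite indexg_gt1 negbK subsetI => /andP[].
Qed.

Hypothesis prime_index : forall x : R, x \notin ring_center R ->
  prime #|centralizer x : ring_center R|%g.

Lemma commuting_adj_centralizer (x y : commuting_graph R) :
  adj x y = (x != y) && (centralizer (val x) == centralizer (val y)).
Proof.
rewrite /= /commuting_adj; congr (_ && _).
have [[xZ yZ]] := (valP x, valP y); apply/eqP/eqP => [xy | cxy].
  by apply/eqP; rewrite eqEsubset !centralizer_sub ?prime_index.
by have := centralizer_id (val y); rewrite -cxy inE => /eqP.
Qed.

(** The class of [x] is [centralizer x] with the center removed: a noncentral element commuting with
    [x] has the same centralizer. *)
Lemma card_centralizer_class (x : commuting_graph R) :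
  #|[set y : commuting_graph R | centralizer (val x) == centralizer (val y)]|
    = (#|ring_center R| * (#|centralizer (val x) : ring_center R|%g).-1)%N.
Proof.
rewrite -subn1 mulnBr muln1 Lagrange ?center_sub_centralizer //.
have := cardsD (centralizer (val x)) (ring_center R).
rewrite (setIidPr (center_sub_centralizer _)) => <-.
rewrite -(card_imset _ val_inj); apply: eq_card => t; rewrite inE.
apply/imsetP/andP => [[y] | [tZ tx]].
  rewrite inE => /eqP cxy ->; split; first exact: (valP y).
  by rewrite cxy centralizer_id.
exists (Sub t tZ : noncentral R); last by rewrite SubK.
move: tx; rewrite !inE SubK => /eqP tx; have xZ := valP x.
by rewrite eqEsubset !centralizer_sub ?prime_index.
Qed.

End Centralizers.

Theorem theorem4p5 (p q : nat) (R : finNzRingType)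
  (p_prime : prime p) (q_prime : prime q)
  (R_noncomm : ~ commutative (@GRing.mul R))
  (card_R : #|R| = (p ^ 3 * q)%N)
  (card_ZR : ~~ prime #|ring_center R|) :
  msn_integral (commuting_graph R) /\ ~ msn_hyperenergetic (commuting_graph R).
Proof.
set Z := ring_center R; have z_gt1 : (1 < #|Z|)%N := ring_center_gt1 R.
have indexE (x : R) : x \notin Z ->
    prime #|centralizer x : Z|%g
    /\ (#|centralizer x : Z|%g ^ 2 = #|[set: R] : Z|%g)%N.
  move=> xZ; have [a_gt1 b_gt1] := centralizer_index_gt1 xZ.
  have abE : (#|[set: R] : centralizer x|%g * #|centralizer x : Z|%g
      = #|[set: R] : Z|%g)%N.
    exact: Lagrange_index (subsetT _) (center_sub_centralizer x).
  have [] := @prime_factors_p3q p q #|Z| #|centralizer x : Z|%g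
               #|[set: R] : centralizer x|%g => //.
    rewrite -mulnA [X in (_ * X)%N]mulnC abE -card_R -cardsT.
    by rewrite Lagrange // subsetT.
  move=> a_prime b_prime; split=> //; rewrite -abE.
  by rewrite (center_index_primes_eq b_prime a_prime (esym abE)).
have prime_index x xZ := proj1 (indexE x xZ).
have [x0 x0Z] : exists x0, x0 \notin Z.
  apply/existsP; apply: contra_notT R_noncomm => /existsPn ZR x y.
  by apply/ring_centerP; have := ZR x; rewrite negbK.
have m_gt2 : (2 < #|Z| * (#|centralizer x0 : Z|%g).-1)%N.
  (* The orders 2 and 3 are excluded as primes; the index is at least 2, so the product is at least
     4. *)
  have z_gt3 : (3 < #|Z|)%N by case: #|Z| z_gt1 card_ZR => [|[|[|[|]]]].
  by have := prime_gt1 (prime_index x0 x0Z); nia.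
have card_class (x : commuting_graph R) :
    #|[set y : commuting_graph R | centralizer (val x) == centralizer (val y)]|
      = (#|Z| * (#|centralizer x0 : Z|%g).-1)%N.
  (* The square of the index is the index of the center in [R], which does not depend on [x]. *)
  rewrite card_centralizer_class //; congr (_ * _.-1)%N; apply/eqP.
  by rewrite -(eqn_exp2r _ _ (isT : 0 < 2)%N) (indexE x0 x0Z).2 (indexE _ (valP x)).2.
have adjE := commuting_adj_centralizer prime_index.
split; first exact: msn_integral_cliques adjE card_class m_gt2.
exact: not_msn_hyperenergetic_cliques adjE card_class m_gt2.
Qed.
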